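(* Assume that the bounded bilinear form $b:Y\times V\to\mathbb{R}$ satisfies the following: there is a constant $C_b>0$ with $$C_b\|y\|_Y\le \sup_{0\ne v\in V}\frac{b(y,v)}{\|v\|_V}\quad\forall y\in Y,\qquad\text{and}\qquad \{v\in V: b(y,v)=0\ \text{for all } y\in Y\}=\{0\}.$$ Assume also that $\Pi:V\to V_h$ is a Fortin operator. Let $(\bar{\mathsf y}_h,\bar{\mathsf u}_h)\in Y_h\times U_{ad,h}$ be the unique solution of the discrete optimal control problem $$\min\{J(\mathsf y_h,\mathsf u_h):(\mathsf y_h,\mathsf u_h)\in Y_h\times U_{ad,h}\}\quad\text{subject to}\quad b(\mathsf y_h,v_h)=\langle D\mathsf u_h,v_h\rangle_{V',V}\ \ \forall v_h\in V_h^{\Theta_h}.$$ Then the discrete optimal control $\bar{\mathsf u}_h$ satisfies $$(\mathcal I_{U'}^{U}D^*\bar{\mathsf p}_h+\alpha\bar{\mathsf u}_h,\ \mathsf u_h-\bar{\mathsf u}_h)_U\ge 0\qquad\forall \mathsf u_h\in U_{ad,h},$$ where $\bar{\mathsf p}_h\in V_h$ is the second component of the unique solution $(\bar\lambda_h,\bar{\mathsf p}_h)\in Y_h\times V_h$ of the discrete adjoint problem $$(\bar{\mathsf p}_h,v_h)_V-b(\bar\lambda_h,v_h)=0,\qquad b(w_h,\bar{\mathsf p}_h)=\langle O^*\mathcal I_{\mathcal Y}^{\mathcal Y'}(O\bar{\mathsf y}_h-\mathsf y_d),w_h\rangle_{Y',Y}\qquad\forall (v_h,w_h)\in V_h\times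 Y_h .$$
   Context: $U,Y,V,\mathcal Y$ are real Hilbert spaces; $U_{ad}\subseteq U$ is non-empty, bounded, closed and convex; $b:Y\times V\to\mathbb{R}$ is a bounded bilinear form; $O:Y\to\mathcal Y$ and $D:U\to V'$ are bounded linear operators; $\mathsf y_d\in\mathcal Y$ and $\alpha>0$ are given. The cost functional is $$J(\mathsf y,\mathsf u):=\tfrac12\|O\mathsf y-\mathsf y_d\|_{\mathcal Y}^2+\tfrac{\alpha}{2}\|\mathsf u\|_U^2 .$$ For a bounded linear operator $T:X\to Z$, $T^*:Z'\to X'$ is its dual; biduals are identified with the original Hilbert spaces, so $D^*:V\to U'$. $\mathcal I_{X}^{X'}:X\to X'$ is the canonical (Riesz) isomorphism, and $\mathcal I_{X'}^{X}$ is its inverse. $V_h\subseteq V$ and $Y_h\subseteq Y$ are finite-dimensional subspaces, and $U_h\subseteq U$ is a (not necessarily discrete) subspace with $U_{ad,h}:=U_h\cap U_{ad}\neq\emptyset$; the choice $U_h=U$ is allowed. The discrete trial-to-test operator $\Theta_h:Y\to V_h$ is defined by $(\Theta_h\mathsf y,v_h)_V=b(\mathsf y,v_h)$ for all $v_h\in V_h$, and $V_h^{\Theta_h}:=\Theta_h(Y_h)$. A map $\Pi:V\to V_h$ is a Fortin operator if there is $C_\Pi>0$ such that $\|\Pi v\|_V\le C_\Pi\|v\|_V$ and $b(\mathsf y_h,v-\Pi v)=0$ for all $\mathsf y_h\in Y_h$ and $v\in V$. *)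

(* Defs.v *)
From HB Require Import structures.
From mathcomp Require Import all_boot all_order all_algebra.
From mathcomp Require Import all_classical all_reals all_analysis.

Set Implicit Arguments.
Unset Strict Implicit.
Unset Printing Implicit Defensive.
Import Order.TTheory GRing.Theory Num.Theory.
Import numFieldNormedType.Exports.
Local Open Scope classical_set_scope.
Local Open Scope ring_scope.

HB.mixin Record CompleteNormedModule_isHilbert (R : realType) (V : Type)
    & CompleteNormedModule R V := {
  hdot : {dot V for idfun} ;
  sqr_norm_hdot : forall x : V, `|x| ^+ 2 = hdot x x
}.

#[short(type="hilbertType")]
HB.structure Definition Hilbert (R : realType) :=
  {V of CompleteNormedModule R V & CompleteNormedModule_isHilbert R V}.

Definition inner (R : realType) (X : hilbertType R) (x y : X) : R :=
  @hdot R X x y.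

Section Inner.
Variables (R : realType) (X : hilbertType R).
Implicit Types x y z : X.

Lemma inner_sqr x : inner x x = `|x| ^+ 2.
Proof. by rewrite sqr_norm_hdot. Qed.

Lemma innerC x y : inner x y = inner y x.
Proof. by rewrite /inner hermitian_subproof expr0 mul1r. Qed.

Lemma inner_linear x : linear (inner x : X -> R^o).
Proof. by move=> a y z; rewrite /inner linearPr. Qed.

Lemma inner0l y : inner 0 y = 0.
Proof. exact: linear0l. Qed.

Lemma innerBl x y z : inner (x - y) z = inner x z - inner y z.
Proof. exact: linearBl. Qed.

Lemma innerZl (a : R) x y : inner (a *: x) y = a * inner x y.
Proof. exact: linearZl_LR. Qed.

Lemma inner_Cauchy_Schwarz (x y : X) : `|inner x y| <= `|x| * `|y|.
Proof.
have [->|y0] := eqVneq y 0; first by rewrite innerC inner0l !normr0 mulr0.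
set c := inner x y / `|y| ^+ 2.
have ny0 : `|y| ^+ 2 != 0 by rewrite expf_neq0// normr_eq0.
have : 0 <= `|x - c *: y| ^+ 2 by rewrite exprn_ge0.
have -> : `|x - c *: y| ^+ 2 = `|x| ^+ 2 - c * inner x y.
  rewrite -inner_sqr innerBl innerZl (innerC x (_ - _)) (innerC y (_ - _)).
  rewrite !innerBl !innerZl (innerC y x) !inner_sqr.
  by rewrite /c divfK// subrr mulr0 subr0.
rewrite subr_ge0 /c mulrAC -expr2.
rewrite ler_pdivrMr ?exprn_gt0 ?normr_gt0// -exprMn => h.
by rewrite -(@ler_pXn2r _ 2) ?nnegrE// ?mulr_ge0// real_normK ?num_real.
Qed.

End Inner.

Section BoundedLinear.
Variables (R : realType) (X Z : normedModType R).

Definition bounded_linear : {pred X -> Z} :=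
  [pred f : X -> Z | `[< linear f /\
     exists M : R, forall x, `|f x| <= M * `|x| >]].

Record boundedLinear : Type := BoundedLinear {
  bl_fun :> X -> Z ;
  _ : bl_fun \in bounded_linear
}.

HB.instance Definition _ := [isSub of boundedLinear for bl_fun].
HB.instance Definition _ := [Choice of boundedLinear by <:].

Lemma bounded_linear_submod_closed : submod_closed bounded_linear.
Proof.
split=> [|a f g].
  apply/asboolP; split=> [a x y|]; first by rewrite /= scaler0 addr0.
  by exists 0 => x; rewrite /= normr0 mul0r.
move=> /asboolP[lf [Mf hf]] /asboolP[lg [Mg hg]].
apply/asboolP; split=> [c x y|].
  rewrite (_ : (a *: f + g) = (fun x => a *: f x + g x)) //.
  by rewrite lf lg !scalerDr !scalerA (mulrC a c) addrACA.
exists (`|a| * Mf + Mg) => x.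
rewrite (_ : (a *: f + g) = (fun x => a *: f x + g x)) //.
rewrite (le_trans (ler_normD _ _))// mulrDl lerD// normrZ -mulrA.
by rewrite ler_wpM2l.
Qed.

HB.instance Definition _ := GRing.isSubmodClosed.Build R (X -> Z)
  bounded_linear bounded_linear_submod_closed.
HB.instance Definition _ :=
  [SubChoice_isSubLmodule of boundedLinear by <:].

Lemma bl_linear (f : boundedLinear) : linear f.
Proof. by case: f => f /= /asboolP[]. Qed.

HB.instance Definition _ (f : boundedLinear) :=
  GRing.isLinear.Build R X Z _ f (@bl_linear f).

Lemma bl_bounded (f : boundedLinear) :
  exists M : R, forall x, `|f x| <= M * `|x|.
Proof. by case: f => f /= /asboolP[]. Qed.

Definition opnorm (f : boundedLinear) : R :=
  sup [set `|f x| | x in [set x : X | `|x| <= 1]].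

Lemma opnorm_has_sup (f : boundedLinear) :
  has_sup [set `|f x| | x in [set x : X | `|x| <= 1]].
Proof.
split; first by exists `|f 0|, 0; rewrite //= normr0.
have [M hM] := bl_bounded f; exists `|M| => _ [x /= x1 <-].
rewrite (le_trans (hM x))// (@le_trans _ _ (`|M| * `|x|))//.
  by rewrite ler_wpM2r// ler_norm.
by rewrite ler_piMr.
Qed.

Lemma ler_opnorm (f : boundedLinear) x : `|f x| <= opnorm f * `|x|.
Proof.
have [->|x0] := eqVneq x 0; first by rewrite linear0 !normr0 mulr0.
have nx0 : 0 < `|x| by rewrite normr_gt0.
rewrite -ler_pdivrMr//.
have -> : `|f x| / `|x| = `|f (`|x|^-1 *: x)|.
  by rewrite linearZ normrZ normfV normr_id mulrC.
apply: (sup_upper_bound (opnorm_has_sup f)); exists (`|x|^-1 *: x) => //=.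
by rewrite normrZ normfV normr_id mulVf// gt_eqF.
Qed.

Lemma opnorm_le (f : boundedLinear) M :
  (forall x, `|x| <= 1 -> `|f x| <= M) -> opnorm f <= M.
Proof.
move=> h; apply: ge_sup; first by case: (opnorm_has_sup f).
by move=> _ [x /= x1 <-]; exact: h.
Qed.

Lemma opnorm_ge0 (f : boundedLinear) : 0 <= opnorm f.
Proof.
apply: (sup_upper_bound (opnorm_has_sup f)).
by exists 0; rewrite /= ?linear0 ?normr0.
Qed.

Lemma opnormD (f g : boundedLinear) : opnorm (f + g) <= opnorm f + opnorm g.
Proof.
apply: opnorm_le => x x1.
have -> : (f + g) x = f x + g x by [].
rewrite (le_trans (ler_normD _ _))// lerD//.
  by rewrite (le_trans (ler_opnorm _ _))// ler_piMr// opnorm_ge0.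
by rewrite (le_trans (ler_opnorm _ _))// ler_piMr// opnorm_ge0.
Qed.

Lemma opnormZ_le (a : R) (f : boundedLinear) :
  opnorm (a *: f) <= `|a| * opnorm f.
Proof.
apply: opnorm_le => x x1.
have -> : (a *: f) x = a *: f x by [].
rewrite normrZ ler_wpM2l//.
by rewrite (le_trans (ler_opnorm _ _))// ler_piMr// opnorm_ge0.
Qed.

Lemma opnorm_eq0 (f : boundedLinear) : opnorm f = 0 -> f = 0.
Proof.
move=> f0; apply/val_inj/funext => x /=; apply/eqP.
by rewrite -normr_le0 (le_trans (ler_opnorm f x))// f0 mul0r.
Qed.

Lemma opnormZ (a : R) (f : boundedLinear) :
  opnorm (a *: f) = `|a| * opnorm f.
Proof.
apply/le_anti; rewrite opnormZ_le/=.
have [->|a0] := eqVneq a 0; first by rewrite normr0 mul0r opnorm_ge0.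
have := opnormZ_le a^-1 (a *: f).
by rewrite scalerA mulVf// scale1r normfV ler_pdivlMl// normr_gt0.
Qed.

HB.instance Definition _ :=
  Lmodule_isNormed.Build R boundedLinear opnormD opnormZ opnorm_eq0.

End BoundedLinear.

Arguments bounded_linear {R} X Z _.

Definition dual_space (R : realType) (X : normedModType R) : Type :=
  boundedLinear X R^o.

Section Dual.
Variable R : realType.

HB.instance Definition _ (X : normedModType R) :=
  NormedModule.copy (dual_space X) (boundedLinear X R^o).

Lemma dual_map_subproof (X Z : normedModType R) (T : boundedLinear X Z)
  (f : dual_space Z) : (f : Z -> R^o) \o T \in bounded_linear X R^o.
Proof.
apply/asboolP; split=> [a x y|]; first by rewrite /= !linearP.
have [M hM] := bl_bounded f; have [N hN] := bl_bounded T.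
exists (`|M| * N) => x; rewrite -mulrA (le_trans (hM _))//.
rewrite (@le_trans _ _ (`|M| * `|T x|))// ?ler_wpM2l//.
by rewrite ler_wpM2r// ler_norm.
Qed.

Definition dual_map (X Z : normedModType R) (T : boundedLinear X Z)
  (f : dual_space Z) : dual_space X := BoundedLinear (dual_map_subproof T f).

Lemma bidual_subproof (X : normedModType R) (x : X) :
  (fun f : dual_space X => f x : R^o) \in bounded_linear (dual_space X) R^o.
Proof.
apply/asboolP; split=> //; exists `|x| => f.
by rewrite mulrC ler_opnorm.
Qed.

(* The canonical map X -> X'', along which X'' is identified with X. *)
Definition bidual (X : normedModType R) (x : X) : dual_space (dual_space X) :=
  BoundedLinear (bidual_subproof x).

Lemma riesz_subproof (X : hilbertType R) (x : X) :
  (inner x : X -> R^o) \in bounded_linear X R^o.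
Proof.
apply/asboolP; split=> [a u v|]; first exact: inner_linear.
by exists `|x| => y; exact: inner_Cauchy_Schwarz.
Qed.

Definition riesz (X : hilbertType R) (x : X) : dual_space X :=
  BoundedLinear (riesz_subproof x).

(* [riesz] is bijective by the Riesz representation theorem; the value 0 of
   [xget] outside its range is never used. *)
Definition riesz_inv (X : hilbertType R) (f : dual_space X) : X :=
  xget 0 [set x | riesz x = f].

End Dual.

Definition linear_subspace (R : realType) (X : normedModType R)
    (A : set X) : Prop :=
  submod_closed (mem A).

Definition fin_dim_subspace (R : realType) (X : normedModType R)
    (A : set X) : Prop :=
  exists (n : nat) (e : 'I_n -> X),
    A = range (fun a : 'rV[R]_n => \sum_i a 0 i *: e i).

Section BilinearForm.
Variables (R : realType) (Y V : hilbertType R).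

Definition bounded_bilinear (b : Y -> V -> R) : Prop :=
  exists M : R, forall y v, `|b y v| <= M * `|y| * `|v|.

(* For V = {0} the real supremum is that of the empty set, which is 0. *)
Definition inf_sup (b : Y -> V -> R) : Prop :=
  exists2 C : R, 0 < C & forall y : Y,
    C * `|y| <= sup [set b y v / `|v| | v in [set v : V | v != 0]].

Definition fortin (b : Y -> V -> R) (Yh : set Y) (Vh : set V) (Pi : V -> V) :
    Prop :=
  (forall v, Vh (Pi v)) /\
  exists2 C : R, 0 < C &
    (forall v, `|Pi v| <= C * `|v|) /\
    (forall y v, Yh y -> b y (v - Pi v) = 0).

(* Such a [t] exists and is unique when [Vh] is a finite-dimensional subspace
   and [b] is a bounded bilinear form. *)
Definition trial_to_test (b : Y -> V -> R) (Vh : set V) (y : Y) : V :=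
  xget 0 [set t | Vh t /\ forall v, Vh v -> inner t v = b y v].

Definition test_space (b : Y -> V -> R) (Yh : set Y) (Vh : set V) : set V :=
  trial_to_test b Vh @` Yh.

End BilinearForm.

Section ControlProblem.
Variables (R : realType) (U Y V Yobs : hilbertType R).

Definition cost (O : boundedLinear Y Yobs) (yd : Yobs) (alpha : R)
    (y : Y) (u : U) : R :=
  2^-1 * `|O y - yd| ^+ 2 + alpha / 2 * `|u| ^+ 2.

Definition discrete_feasible (b : Y -> V -> R)
    (D : boundedLinear U (dual_space V))
    (Uad Uh : set U) (Yh : set Y) (Vh : set V) (y : Y) (u : U) : Prop :=
  [/\ Yh y, (Uh `&` Uad) u &
      forall v, test_space b Yh Vh v -> b y v = D u v].

Definition discrete_optimal (b : Y -> V -> R)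
    (D : boundedLinear U (dual_space V))
    (O : boundedLinear Y Yobs) (yd : Yobs) (alpha : R)
    (Uad Uh : set U) (Yh : set Y) (Vh : set V) (y : Y) (u : U) : Prop :=
  discrete_feasible b D Uad Uh Yh Vh y u /\
  forall y' u', discrete_feasible b D Uad Uh Yh Vh y' u' ->
    cost O yd alpha y u <= cost O yd alpha y' u'.

Definition discrete_adjoint (b : Y -> V -> R) (O : boundedLinear Y Yobs)
    (yd : Yobs) (Yh : set Y) (Vh : set V) (ybar : Y) (lambda : Y) (p : V) :
    Prop :=
  [/\ Yh lambda, Vh p &
      forall v w, Vh v -> Yh w ->
        inner p v - b lambda v = 0 /\
        b w p = dual_map O (riesz (O ybar - yd)) w].

End ControlProblem.

(* Main.v *)
(* By the Fortin property and the inf-sup condition, Theta_h is injective on Y_h.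
   Since b(y, Theta_h w) = (Theta_h y, Theta_h w)_V, both the state equation tested
   on Theta_h(Y_h) and the adjoint problem reduce to a Gram system on Y_h, and the
   adjoint state is p_h = Theta_h lambda_h. In particular p_h is an admissible
   test function for the state equation, which identifies the directional
   derivative of J along the feasible segment from (y_h, u_h) to another
   state-control pair with the left-hand side of the variational inequality. *)
Require Import Defs.
From HB Require Import structures.
From mathcomp Require Import all_boot all_order all_algebra.
From mathcomp Require Import all_classical all_reals all_analysis.
From mathcomp Require Import ring lra.

Set Implicit Arguments.
Unset Strict Implicit.
Unset Printing Implicit Defensive.
Import Order.TTheory GRing.Theory Num.Theory.
Import numFieldNormedType.Exports.
Local Open Scope classical_set_scope.
Local Open Scope ring_scope.

(** * Algebra of the inner product and squared norms *)

Section InnerProduct.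
Variables (R : realType) (X : hilbertType R).
Implicit Types x y z : X.

HB.instance Definition _ x :=
  GRing.isLinear.Build R X R^o _ (inner x) (inner_linear x).

Lemma innerDl x y z : inner (x + y) z = inner x z + inner y z.
Proof. by rewrite !(innerC _ z) linearD. Qed.

Lemma innerDr x y z : inner x (y + z) = inner x y + inner x z.
Proof. exact: linearD. Qed.

Lemma innerBr x y z : inner x (y - z) = inner x y - inner x z.
Proof. exact: linearB. Qed.

Lemma innerZr (a : R) x y : inner x (a *: y) = a * inner x y.
Proof. exact: linearZ. Qed.

Lemma inner_sumr n x (F : 'I_n -> X) :
  inner x (\sum_i F i) = \sum_i inner x (F i).
Proof. exact: linear_sum. Qed.

Lemma inner_suml n (F : 'I_n -> X) y :
  inner (\sum_i F i) y = \sum_i inner (F i) y.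
Proof. by rewrite innerC inner_sumr; apply: eq_bigr => i _; exact: innerC. Qed.

Lemma inner_eq0 x : inner x x = 0 -> x = 0.
Proof. by rewrite inner_sqr => /eqP; rewrite expf_eq0 normr_eq0 => /eqP. Qed.

Lemma sqr_normD x y : `|x + y| ^+ 2 = `|x| ^+ 2 + 2 * inner x y + `|y| ^+ 2.
Proof. by rewrite -!inner_sqr innerDl !innerDr (innerC y x); ring. Qed.

Lemma sqr_normB x y : `|x - y| ^+ 2 = `|x| ^+ 2 - 2 * inner x y + `|y| ^+ 2.
Proof. by rewrite -!inner_sqr innerBl !innerBr (innerC y x); ring. Qed.

End InnerProduct.

(** * Riesz representation theorem *)

Section Riesz.
Variables (R : realType) (X : hilbertType R) (f : dual_space X).

(* The Riesz representative of [f] is the minimizer of this functional. *)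
Let energy (x : X) : R := `|x| ^+ 2 - 2 * f x.

Let energyD x y :
  energy (x + y) = energy x + 2 * (inner x y - f y) + `|y| ^+ 2.
Proof. by rewrite /energy sqr_normD linearD /=; ring. Qed.

Let energy_has_inf : has_inf (range energy).
Proof.
split; first by exists (energy 0), 0.
exists (- opnorm f ^+ 2) => _ [x _ <-]; rewrite /energy.
have : f x <= opnorm f * `|x|.
  exact: le_trans (ler_norm _) (ler_opnorm f x).
by have := sqr_ge0 (`|x| - opnorm f); nra.
Qed.

Let m := inf (range energy).

Let energy_ge x : m <= energy x.
Proof. by apply: ge_inf; [case: energy_has_inf | exists x]. Qed.

(** The slack is a square so that the diameter of the set is bounded linearly in [e]. *)
Let near_min (e : R) : set X := [set x | energy x < m + e ^+ 2].

Let near_min_neq0 e : 0 < e -> near_min e !=set0.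
Proof.
move=> e0; have e20 : 0 < e ^+ 2 by rewrite exprn_gt0.
by have [_ [x _ <-] xm] := inf_adherent e20 energy_has_inf; exists x.
Qed.

(* Parallelogram identity, with the energy of the midpoint of x and y. *)
Let near_min_dist e x y : 0 < e -> near_min e x -> near_min e y ->
  `|x - y| <= 2 * e.
Proof.
rewrite /near_min /= => e0 xe ye.
have e2 : 0 <= 2 * e by lra.
rewrite -(@ler_pXn2r _ 2) ?nnegrE//.
have := energy_ge (2^-1 *: (x + y)); move: xe ye; rewrite /energy.
have -> : f (2^-1 *: (x + y)) = 2^-1 * (f x + f y) by rewrite linearZ linearD.
rewrite normrZ exprMn sqr_normD sqr_normB.
rewrite ger0_norm ?invr_ge0//.
by move=> *; nra.
Qed.

(** Since [m] bounds the energy below, no step along [h] can lower it by [e ^+ 2] or more; a large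
    first variation at [x] would allow such a decrease. *)
Let near_min_stationary e x h : 0 < e -> near_min e x ->
  `|inner x h - f h| <= e * (`|h| ^+ 2 + 1).
Proof.
rewrite /near_min /= => e0 xe.
set l := _ - _; set q := `|h| ^+ 2.
have q0 : 0 <= q by rewrite sqr_ge0.
have q1 : 0 < q + 1 by lra.
(* This step minimizes [2 * s * l + s ^+ 2 * (q + 1)]; the added 1 keeps the denominator positive
   when [h] is 0. *)
pose s := - l / (q + 1).
have lE : l = - s * (q + 1) by rewrite mulNr divfK ?opprK// gt_eqF.
have := energy_ge (x + s *: h).
have fs : f (s *: h) = s * f h by exact: linearZ.
rewrite energyD innerZr fs normrZ exprMn real_normK ?num_real//.
rewrite -/q -mulrBr -/l {1}lE => me.
rewrite lE normrM (gtr0_norm q1) normrN ler_wpM2r ?(ltW q1)//.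
rewrite -(@ler_pXn2r _ 2) ?nnegrE ?(ltW e0)// real_normK ?num_real//.
have : 0 <= s ^+ 2 * q by rewrite mulr_ge0 ?sqr_ge0.
have : s * (- s * (q + 1)) = - (s ^+ 2 * q + s ^+ 2) by ring.
by have := sqr_ge0 s; lra.
Qed.

(** The sets of near-minimizers generate a Cauchy filter; completeness gives it a limit, where
    approximate stationarity becomes exact. *)
Lemma riesz_surj : exists x : X, riesz x = f.
Proof.
pose F : set_system X := filter_from [set e | 0 < e] near_min.
have FF : ProperFilter F.
  apply: filter_from_proper; last by move=> e /= /near_min_neq0.
  apply: filter_from_filter; first by exists 1 => /=.
  move=> i j /= i0 j0; exists (Num.min i j); first by rewrite /= lt_min i0.
  have le2 k : 0 < k -> Num.min i j <= k ->
      near_min (Num.min i j) `<=` near_min k.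
    move=> k0 mk x; rewrite /near_min /= => /lt_le_trans; apply.
    by rewrite lerD2l ler_pXn2r// nnegrE ltW// lt_min i0.
  by move=> x xm; split; apply: le2 xm; rewrite // ge_min lexx ?orbT.
have /cvg_ex[/= x Fx] : cvg F.
  apply: cauchy_cvg; apply/cauchyP => _/posnumP[e].
  have e3 : 0 < e%:num / 3 by rewrite divr_gt0.
  have [x xe] := near_min_neq0 e3.
  exists x; exists (e%:num / 3) => // y ye.
  rewrite -ball_normE /=; apply: le_lt_trans (near_min_dist e3 xe ye) _.
  by have := gt0 e; lra.
exists x; apply/val_inj/funext => h /=.
apply/eqP; rewrite -subr_eq0 -normr_le0.
apply/ler_addgt0Pr => e e0; rewrite add0r.
(* The first summand is the Cauchy-Schwarz factor for [x - y], the rest the stationarity factor for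
   [y], so the two errors add up to [e]. *)
set K := `|h| + (`|h| ^+ 2 + 1).
have K0 : 0 < K by rewrite !ltr_wpDl ?sqr_ge0.
have eK : 0 < e / K by rewrite divr_gt0.
have [y [xy ye]] : ball x (e / K) `&` near_min (e / K) !=set0.
  have Fnear : F (near_min (e / K)) by exists (e / K).
  have Fball : F (ball x (e / K)) by apply: Fx; exact: nbhsx_ballx.
  exact: filter_ex (filterI Fball Fnear).
have -> : inner x h - f h = inner (x - y) h + (inner y h - f h).
  by rewrite innerBl; ring.
apply: le_trans (ler_normD _ _) _.
have -> : e = e / K * `|h| + e / K * (`|h| ^+ 2 + 1).
  by rewrite -mulrDr divfK// gt_eqF.
rewrite lerD//; last exact: near_min_stationary.
apply: le_trans (inner_Cauchy_Schwarz _ _) _.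
by rewrite ler_wpM2r// ltW//; move: xy; rewrite -ball_normE.
Qed.

Lemma inner_riesz_inv h : inner (riesz_inv f) h = f h.
Proof.
by rewrite /riesz_inv; have /(xgetPex 0) /= {2}<- := riesz_surj.
Qed.

End Riesz.

(** * Gram systems on finite-dimensional subspaces *)

Section FiniteDimensional.
Variable R : realType.

Lemma fin_dim_subspace_closed (X : hilbertType R) (S : set X) :
  fin_dim_subspace S -> forall (a : R) x y, S x -> S y -> S (a *: x + y).
Proof.
move=> [n [e ->]] a _ _ [u _ <-] [v _ <-]; exists (a *: u + v) => //.
rewrite scaler_sumr -big_split; apply: eq_bigr => i _ /=.
by rewrite !mxE scalerDl scalerA.
Qed.

(* The Gram matrix G of the images of generators may be singular, but any z with
   G z = 0 represents the zero vector, so the right-hand side lies in the row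
   space of G. *)
Lemma fin_dim_representation (X Z : hilbertType R) (S : set X)
    (T : {linear X -> Z}) (L : {linear X -> R^o}) :
  fin_dim_subspace S -> (forall x, S x -> T x = 0 -> x = 0) ->
  exists2 w, S w & forall x, S x -> inner (T w) (T x) = L x.
Proof.
move=> [n [e ->]] Tinj.
pose comb (a : 'rV[R]_n) := \sum_i a 0 i *: e i.
pose G := \matrix_(i < n, j < n) inner (T (e i)) (T (e j)).
pose r := \row_(j < n) (L (e j) : R).
have TE a : T (comb a) = \sum_i a 0 i *: T (e i).
  by rewrite linear_sum; apply: eq_bigr => i _; rewrite linearZ.
have GE a c : inner (T (comb a)) (T (comb c)) = (a *m G *m c^T) 0 0.
  rewrite !TE inner_sumr mxE; apply: eq_bigr => j _.
  rewrite inner_suml !mxE mulr_suml; apply: eq_bigr => i _.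
  by rewrite innerZl innerZr !mxE; ring.
have rE (c : 'rV[R]_n) : L (comb c) = (r *m c^T) 0 0.
  rewrite linear_sum mxE; apply: eq_bigr => j _.
  by rewrite linearZ !mxE mulrC.
(* Row-space membership is tested on the columns of [cokermx G], which span the kernel of [G]. *)
have /submxP[a ra] : (r <= G)%MS.
  rewrite submxE; apply/eqP/matrixP => i k; rewrite ord1 mxE [RHS]mxE.
  pose z := col k (cokermx G).
  have Gz : G *m z = 0 by rewrite /z colE mulmxA mulmx_coker mul0mx.
  have /Tinj z0 : range comb (comb z^T) by exists z^T.
  (* The quadratic form of [G] at [z] is the squared norm of [T (comb z^T)], so injectivity
     applies. *)
  have : L (comb z^T) = 0.
    rewrite z0 ?linear0//; apply: inner_eq0.
    by rewrite GE trmxK -mulmxA Gz mulmx0 mxE.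
  rewrite rE trmxK mxE => rz; rewrite -[RHS]rz.
  by apply: eq_bigr => j _; rewrite [z _ _]mxE.
exists (comb a); first by exists a.
by move=> _ [c _ <-]; rewrite [LHS]GE [RHS]rE ra.
Qed.

End FiniteDimensional.

(** * The trial-to-test operator and the discrete state and adjoint equations *)

Section DiscreteProblem.
Variables (R : realType) (Y V : hilbertType R) (b : {bilinear Y -> V -> R^o}).
Variables (Vh : set V) (Yh : set Y).
Hypotheses (Vh_findim : fin_dim_subspace Vh) (Yh_findim : fin_dim_subspace Yh).

Local Notation Theta := (trial_to_test b Vh).

(** A Gram system on [Vh] itself, with the identity as [T], yields a witness, so [xget] does not
    return its default. *)
Lemma trial_to_testP y :
  Vh (Theta y) /\ forall v, Vh v -> inner (Theta y) v = b y v.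
Proof.
apply: (xgetPex 0
  (P := [set t | Vh t /\ forall v, Vh v -> inner t v = b y v])).
have [w Sw wE] := fin_dim_representation (T := idfun) (b y) Vh_findim
  (fun _ _ => id).
by exists w.
Qed.

Lemma inner_inj_subspace (S : set V) s t : fin_dim_subspace S -> S s -> S t ->
  (forall v, S v -> inner s v = inner t v) -> s = t.
Proof.
move=> Sfd Ss St st; apply/eqP; rewrite -subr_eq0; apply/eqP/inner_eq0.
have Sst : S (s - t) by rewrite addrC -scaleN1r; exact: fin_dim_subspace_closed.
by rewrite innerBl st// subrr.
Qed.

Lemma trial_to_test_linear : linear Theta.
Proof.
move=> a x y; have [[Vx xE] [Vy yE]] := (trial_to_testP x, trial_to_testP y).
have [Vxy xyE] := trial_to_testP (a *: x + y).
apply: (inner_inj_subspace Vh_findim) => //.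
  exact: fin_dim_subspace_closed.
move=> v Vv; rewrite xyE// innerDl innerZl xE// yE//.
by rewrite linearPl.
Qed.

HB.instance Definition _ :=
  GRing.isLinear.Build R Y V _ Theta trial_to_test_linear.

Lemma bilinear_trial_to_test y w : b y (Theta w) = inner (Theta y) (Theta w).
Proof.
by have [_ ->] := trial_to_testP y; have [] := trial_to_testP w.
Qed.

(* For y in [Yh], b(y, v) = b(y, Pi v) = (Theta y, Pi v), so Theta y = 0 makes the
   supremum in the inf-sup condition vanish. *)
Lemma trial_to_test_inj (Pi : V -> V) : inf_sup b -> fortin b Yh Vh Pi ->
  forall y, Yh y -> Theta y = 0 -> y = 0.
Proof.
move=> [C C0 Cb] [VPi [_ _ [_ bPi]]] y Yy y0.
have by0 v : b y v = 0.
  have := bPi y v Yy; rewrite linearBr => /eqP; rewrite subr_eq0 => /eqP ->.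
  by have [_ <-//] := trial_to_testP y; rewrite y0 inner0l.
have := Cb y; set S := (X in sup X) => CS.
have S0 : sup S <= 0.
  (* The set is empty when [V] is trivial; its supremum is then 0 by convention. *)
  have [->|/set0P Sn0] := eqVneq S set0; first by rewrite sup0.
  by apply: ge_sup => // _ [v _ <-]; rewrite by0 mul0r.
apply/eqP; rewrite -normr_le0 -(ler_pM2l C0) mulr0.
exact: le_trans CS S0.
Qed.

Hypothesis Theta_inj : forall y, Yh y -> Theta y = 0 -> y = 0.

Lemma trial_to_test_solve (L : {linear Y -> R^o}) :
  exists2 w, Yh w & forall y, Yh y -> inner (Theta w) (Theta y) = L y.
Proof. exact: fin_dim_representation. Qed.

Lemma trial_to_test_unique w w' : Yh w -> Yh w' ->
  (forall y, Yh y -> inner (Theta w) (Theta y) = inner (Theta w') (Theta y)) ->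
  w = w'.
Proof.
move=> Yw Yw' ww'; apply/eqP; rewrite -subr_eq0; apply/eqP.
have Yd : Yh (w - w').
  by rewrite addrC -scaleN1r; exact: fin_dim_subspace_closed.
apply: Theta_inj => //; apply: inner_eq0.
by rewrite {1}linearB innerBl ww'// subrr.
Qed.

Lemma state_exists (F : dual_space V) :
  exists2 y, Yh y & forall v, test_space b Yh Vh v -> b y v = F v.
Proof.
have [y Yy yE] := trial_to_test_solve ((F : {linear V -> R^o}) \o Theta).
by exists y => // _ [w Yw <-]; rewrite bilinear_trial_to_test yE.
Qed.

Lemma state_unique y y' : Yh y -> Yh y' ->
  (forall v, test_space b Yh Vh v -> b y v = b y' v) -> y = y'.
Proof.
move=> Yy Yy' yy'; apply: trial_to_test_unique => // w Yw.
by rewrite -!bilinear_trial_to_test; apply: yy'; exists w.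
Qed.

Variables (Yobs : hilbertType R) (O : boundedLinear Y Yobs) (yd : Yobs).
Variable (ybar : Y).

(** The first adjoint equation is the one defining [Theta lambda]; [lambda] itself fills the
    irrelevant slot [w]. *)
Lemma discrete_adjoint_trial_to_test lambda p :
  discrete_adjoint b O yd Yh Vh ybar lambda p -> p = Theta lambda.
Proof.
move=> [Yl Vp adj]; have [Vt tE] := trial_to_testP lambda.
apply: (inner_inj_subspace Vh_findim) => // v Vv; rewrite tE//.
by have [/eqP] := adj v lambda Vv Yl; rewrite subr_eq0 => /eqP.
Qed.

(** With [p = Theta lambda], symmetry of the inner product turns the second equation into the Gram
    system for [lambda]. *)
Lemma discrete_adjoint_exists_unique :
  exists! lp : Y * V, discrete_adjoint b O yd Yh Vh ybar lp.1 lp.2.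
Proof.
have [l Yl lE] := trial_to_test_solve (dual_map O (riesz (O ybar - yd))).
have [Vt tE] := trial_to_testP l.
exists (l, Theta l); split=> [|[l' p'] /= adj].
  split=> // v w Vv Yw; split; first by rewrite tE// subrr.
  by rewrite bilinear_trial_to_test innerC lE.
have p'E := discrete_adjoint_trial_to_test adj.
case: adj => Yl' Vp' adj'; suff -> : l = l' by rewrite -p'E.
apply: trial_to_test_unique => // y Yy.
have [_ adjE] := adj' _ _ Vp' Yy.
by rewrite lE// -[LHS]adjE p'E bilinear_trial_to_test innerC.
Qed.

End DiscreteProblem.

(** * First-order optimality for the quadratic cost *)

Lemma cost_expansion (R : realType) (U Y Yobs : hilbertType R)
    (O : boundedLinear Y Yobs) (yd : Yobs) (alpha : R) (y z : Y) (u w : U)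
    (t : R) :
  cost O yd alpha (y + t *: z) (u + t *: w) = cost O yd alpha y u +
    t * (inner (O y - yd) (O z) + alpha * inner u w) +
    t ^+ 2 * (2^-1 * `|O z| ^+ 2 + alpha / 2 * `|w| ^+ 2).
Proof.
rewrite /cost.
have -> : O (y + t *: z) - yd = (O y - yd) + t *: O z.
  by rewrite linearD linearZ /= addrAC.
rewrite !sqr_normD !innerZr !normrZ !exprMn !real_normK ?num_real//.
by field.
Qed.

Lemma ge0_of_quadratic_ge0 (R : realFieldType) (l q : R) :
  (forall t, 0 < t -> t <= 1 -> 0 <= t * l + t ^+ 2 * q) -> 0 <= l.
Proof.
move=> lq; rewrite leNgt; apply/negP => l0.
(* For this [t], [l + t * q <= l + t * |q| = t * l < 0], a contradiction. *)
pose t := - l / (`|q| - l).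
have q0 : 0 <= `|q| by [].
have d0 : 0 < `|q| - l by lra.
have t0 : 0 < t by rewrite divr_gt0//; lra.
have t1 : t <= 1 by rewrite ler_pdivrMr//; lra.
have := lq t t0 t1; rewrite expr2 -mulrA -mulrDr pmulr_rge0//.
have tE : t * (`|q| - l) = - l by rewrite divfK// gt_eqF.
have : t * q <= t * `|q| by rewrite ler_pM2l// ler_norm.
by nra.
Qed.

Theorem theorem4p4 (R : realType) (U Y V Yobs : hilbertType R)
    (Uad : set U)
    (Uad_neq0 : Uad !=set0) (Uad_bounded : bounded_set Uad)
    (Uad_closed : closed Uad) (Uad_convex : convex_set Uad)
    (b : {bilinear Y -> V -> R^o}) (b_bounded : bounded_bilinear b)
    (O : boundedLinear Y Yobs) (D : boundedLinear U (dual_space V))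
    (yd : Yobs) (alpha : R) (alpha_gt0 : 0 < alpha)
    (Vh : set V) (Vh_findim : fin_dim_subspace Vh)
    (Yh : set Y) (Yh_findim : fin_dim_subspace Yh)
    (Uh : set U) (Uh_subspace : linear_subspace Uh)
    (Uadh_neq0 : Uh `&` Uad !=set0)
    (b_inf_sup : inf_sup b)
    (b_nondegenerate : [set v : V | forall y : Y, b y v = 0] = [set 0])
    (Pi : V -> V) (Pi_fortin : fortin b Yh Vh Pi)
    (ybar : Y) (ubar : U)
    (opt : discrete_optimal b D O yd alpha Uad Uh Yh Vh ybar ubar) :
  [/\ forall y u, discrete_optimal b D O yd alpha Uad Uh Yh Vh y u ->
        (y, u) = (ybar, ubar),
      exists! lp : Y * V, discrete_adjoint b O yd Yh Vh ybar lp.1 lp.2 &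
      forall (lambda : Y) (p : V),
        discrete_adjoint b O yd Yh Vh ybar lambda p ->
        forall u, (Uh `&` Uad) u ->
          0 <= inner (riesz_inv (dual_map D (bidual p)) + alpha *: ubar)
                     (u - ubar)].
Proof.
have Theta_inj := trial_to_test_inj Vh_findim b_inf_sup Pi_fortin.
have [[Yy [Uhu Uadu] state] min] := opt.
have direction y u t : discrete_feasible b D Uad Uh Yh Vh y u ->
    0 < t -> t <= 1 ->
    discrete_feasible b D Uad Uh Yh Vh (ybar + t *: (y - ybar))
      (ubar + t *: (u - ubar)).
  move=> [Yy' [Uhu' Uadu'] state'] t0 t1; split.
  - have -> : ybar + t *: (y - ybar) = t *: (-1 *: ybar + y) + ybar.
      by rewrite scaleN1r addrC [- _ + _]addrC.
    by do 2![apply: fin_dim_subspace_closed => //].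
  - split.
      have Ulin a x y' : Uh x -> Uh y' -> Uh (a *: x + y').
        move=> /mem_set Ux /mem_set Uy'; apply: set_mem.
        by case: Uh_subspace => _; apply.
      rewrite addrC; apply: (Ulin) => //.
      by rewrite addrC -scaleN1r; exact: Ulin.
    (* The convex combination gives weight [t] to [u] and [1 - t] to [ubar]. *)
    have := Uad_convex u ubar (Itv01 (ltW t0) t1).
    rewrite !in_setE => /(_ Uadu' Uadu).
    congr (Uad _); rewrite /conv /= /unstable.onem scalerBl scalerBr scale1r.
    by rewrite addrCA.
  - move=> v Tv; have := state _ Tv; have := state' _ Tv.
    rewrite linearDl linearZl_LR linearBl => -> ->.
    have -> : D (ubar + t *: (u - ubar)) = D ubar + t *: (D u - D ubar).
      by rewrite linearD linearZ linearB.
    by [].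
have derivative_ge0 y u : discrete_feasible b D Uad Uh Yh Vh y u ->
    0 <= inner (O ybar - yd) (O (y - ybar)) + alpha * inner ubar (u - ubar).
  move=> yu.
  pose q := 2^-1 * `|O (y - ybar)| ^+ 2 + alpha / 2 * `|u - ubar| ^+ 2.
  apply: (ge0_of_quadratic_ge0 (q := q)) => t t0 t1.
  have := min _ _ (direction y u t yu t0 t1).
  by rewrite cost_expansion -addrA lerDl.
split.
- move=> y u [yu yu_min]; have := yu_min _ _ opt.1.
  have := derivative_ge0 _ _ yu.
  (* At [t = 1] the expansion compares two minimizers: the linear term is nonnegative, so the
     quadratic term cannot be positive, and [alpha > 0] forces equal controls. *)
  have := cost_expansion O yd alpha ybar (y - ybar) ubar (u - ubar) 1.
  rewrite !scale1r !subrKC => -> d0 le_opt.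
  have eq_u : u = ubar.
    apply/eqP; rewrite -subr_eq0 -normr_eq0 -sqrf_eq0 eq_le sqr_ge0 andbT.
    rewrite -(ler_pM2l alpha_gt0) mulr0.
    by have := sqr_ge0 `|O (y - ybar)|; lra.
  case: yu => Yy' _ state'; rewrite eq_u; congr (_, _).
  apply: (state_unique Vh_findim Yh_findim Theta_inj) => // v Tv.
  by rewrite state'// state// eq_u.
- exact: discrete_adjoint_exists_unique.
move=> lambda p adj u [Uhu' Uadu'].
have pE := discrete_adjoint_trial_to_test Vh_findim adj.
(* Each admissible control has a discrete state, so the derivative inequality for feasible pairs
   applies to it. *)
have [y Yy' state'] := state_exists Vh_findim Yh_findim Theta_inj (D u).
have /derivative_ge0 : discrete_feasible b D Uad Uh Yh Vh y u by [].
rewrite innerDl innerZl inner_riesz_inv.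
case: adj => Yl Vp adj.
have Yd : Yh (y - ybar).
  by rewrite addrC -scaleN1r; exact: fin_dim_subspace_closed.
(* The adjoint equation tested with [y - ybar] turns the derivative of the tracking term into
   [b (y - ybar) p]. *)
have [_ /= <-] := adj p (y - ybar) Vp Yd.
(* Both state equations may thus be tested with [p], which gives [D (u - ubar) p]. *)
have Tp : test_space b Yh Vh p by exists lambda.
have -> : D (u - ubar) p = D u p - D ubar p by rewrite linearB.
by rewrite linearBl /= state'// state.
Qed.
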